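(* Let $m, d$ be integers with $m \ge d \ge 2$. Let $P$ be a random set of $N := m^d$ points in $[0,1)^d$ obtained from jittered sampling. Then \[ \mathbb{E}\, D^*(P) \ \le\ 60.9984\, \sqrt{d m^d}\; \frac{\sqrt{\ln(4em/d)} + 2.9599}{\sqrt{m/d}} . \]
   Context: For an $N$-point set $P \subseteq [0,1)^d$ and a Lebesgue-measurable set $A$, let $\operatorname{disc}_P(A) := |P \cap A| - N\lambda(A)$, where $\lambda$ is the Lebesgue measure. The (non-normalized) star discrepancy of $P$ is $D^*(P) := \sup_{x \in [0,1)^d} |\operatorname{disc}_P([0,x))|$, where $[0,x) := \prod_{i=1}^d [0,x_i)$. Jittered sampling: for positive integers $m,d$, partition $[0,1)^d$ into the $m^d$ cubes ($m$-cubes) $\prod_{i=1}^d [q_i, q_i + \frac1m)$ with $q \in \{0,\frac1m,\dots,\frac{m-1}{m}\}^d$. A jittered sampling point set of $N=m^d$ points is the random set obtained by choosing, independently for each $m$-cube, one point uniformly at random in that cube. Here $\ln$ is the natural logarithm and $e$ is Euler's number. *)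

(* Defs.v *)
From HB Require Import structures.
From mathcomp Require Import all_boot all_order all_algebra finmap.
From mathcomp Require Import all_classical all_reals all_analysis.

Set Implicit Arguments.
Unset Strict Implicit.
Unset Printing Implicit Defensive.

Import Order.TTheory GRing.Theory Num.Theory.
Import numFieldNormedType.Exports.

Local Open Scope fset_scope.
Local Open Scope classical_set_scope.
Local Open Scope ring_scope.

(* Lebesgue measure on R^d (points of R^d are d-tuples), as the d-fold product
   of the one-dimensional one, along R^(n+1) = R * R^n. *)
Fixpoint lebesgue_tuple (R : realType) (n : nat) :
    set (n.-tuple R) -> \bar R :=
  match n return set (n.-tuple R) -> \bar R with
  | 0%N => \d_([tuple] : 0.-tuple R)
  | n'.+1 => fun A => (lebesgue_measure \x @lebesgue_tuple R n')%E
      [set p : R * n'.-tuple R | A [tuple of p.1 :: p.2]]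
  end.

Definition box (R : realType) (d : nat) (a b : 'I_d -> R) : set (d.-tuple R) :=
  [set y | forall i, a i <= tnth y i < b i].

Lemma lebesgue_tuple0 (R : realType) (n : nat) :
  lebesgue_tuple (set0 : set (n.-tuple R)) = 0%E.
Proof.
elim: n => [|n IHn] /=; first by rewrite dirac0.
rewrite [X in product_measure1 _ _ X](_ : _ = set0); last by apply/seteqP; split.
rewrite /product_measure1.
by rewrite integral0_eq// => x _ /=; rewrite xsection0.
Qed.

Lemma lebesgue_tuple_box (R : realType) (d : nat) (a b : 'I_d -> R) :
  (forall i, a i <= b i) ->
  lebesgue_tuple (box a b) = (\prod_(i < d) (b i - a i))%:E.
Proof.
elim: d a b => [|d IH] a b ab /=.
  by rewrite big_ord0 diracE mem_set//; case.
set B := [set t | _]; have -> : B = `[a ord0, b ord0[%classic `*`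
    box (a \o lift ord0) (b \o lift ord0).
  apply/seteqP; split=> [[x t] /= h|[x t] /= [h1 h2] i]; rewrite ?in_itv/=.
    split=> [|i /=]; first by have := h ord0; rewrite tnth0.
    by have := h (lift ord0 i); rewrite tnthS.
  case: (unliftP ord0 i) => [j|] ->; rewrite ?tnthS ?tnth0; first exact: h2.
  by move: h1; rewrite in_itv.
rewrite /product_measure1 big_ord_recl.
transitivity (\int[@lebesgue_measure R]_(x in `[a ord0, b ord0[)
  (\prod_(i < d) (b (lift ord0 i) - a (lift ord0 i)))%:E)%E.
  rewrite [RHS]integral_mkcond; apply: eq_integral => x _ /=; rewrite patchE.
  case: ifPn => xab.
    by rewrite in_xsectionX// IH// => i; exact: ab.
  by rewrite notin_xsectionX// lebesgue_tuple0.
rewrite integral_cst//= lebesgue_measure_itv/= lte_fin.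
case: ltP => [_|ba]; first by rewrite -EFinB -EFinM mulrC.
by rewrite mule0 (@le_anti _ _ (a ord0) (b ord0)) ?subrr ?mul0r// ab.
Qed.

Definition unit_cube (R : realType) (d : nat) : set (d.-tuple R) :=
  box (fun=> 0) (fun=> 1).

Definition anchored_box (R : realType) (d : nat) (x : d.-tuple R) :
    set (d.-tuple R) :=
  box (fun=> 0) (tnth x).

(* The m-cube with corner q / m, q ranging over {0, ..., m - 1}^d. *)
Definition m_cube (R : realType) (m d : nat) (q : d.-tuple 'I_m) :
    set (d.-tuple R) :=
  box (fun i => (tnth q i)%:R / m%:R)
      (fun i => (tnth q i)%:R / m%:R + m%:R^-1).

Definition disc (R : realType) (d : nat) (P : {fset d.-tuple R})
    (A : set (d.-tuple R)) : R :=
  #|` [fset p in P | p \in A]|%:R - #|` P|%:R * fine (lebesgue_tuple A).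

Definition star_discrepancy (R : realType) (d : nat) (P : {fset d.-tuple R}) :
    R :=
  sup [set `|disc P (anchored_box x)| | x in @unit_cube R d].

Definition mutually_independent (dO dE : measure_display)
    (Omega : measurableType dO) (E : measurableType dE) (R : realType)
    (Pr : probability Omega R) (I : finType) (X : I -> Omega -> E) : Prop :=
  forall (J : {set I}) (A : I -> set E), (forall i, measurable (A i)) ->
    Pr (\bigcap_(i in [set` J]) (X i @^-1` A i)) =
    (\prod_(i in J) Pr (X i @^-1` A i))%E.

Definition uniform_on (dO : measure_display) (Omega : measurableType dO)
    (R : realType) (Pr : probability Omega R) (d : nat)
    (C : set (d.-tuple R)) (X : {RV Pr >-> d.-tuple R}) : Prop :=
  forall A : set (d.-tuple R), measurable A ->
    distribution Pr X A =
    (fine (lebesgue_tuple (A `&` C)) / fine (lebesgue_tuple C))%:E.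

(* [X q] is the random point chosen in the m-cube of index [q]. *)
Definition jittered_sampling (dO : measure_display)
    (Omega : measurableType dO) (R : realType) (Pr : probability Omega R)
    (m d : nat) (X : d.-tuple 'I_m -> {RV Pr >-> d.-tuple R}) : Prop :=
  [/\ forall q w, m_cube q (X q w),
      forall q, uniform_on (m_cube q) (X q) &
      mutually_independent Pr (fun q => X q : Omega -> d.-tuple R)].

Definition jittered_point_set (dO : measure_display)
    (Omega : measurableType dO) (R : realType) (Pr : probability Omega R)
    (m d : nat) (X : d.-tuple 'I_m -> {RV Pr >-> d.-tuple R}) (w : Omega) :
    {fset d.-tuple R} :=
  [fset X q w | q in {: d.-tuple 'I_m}].

(* Main.v *)
Require Import Defs.
From HB Require Import structures.
From mathcomp Require Import all_boot all_order all_algebra finmap.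
From mathcomp Require Import all_classical all_reals all_analysis.
From mathcomp Require Import measurable_realfun ring lra zify.

Set Implicit Arguments.
Unset Strict Implicit.
Unset Printing Implicit Defensive.

Import Order.TTheory GRing.Theory Num.Theory.
Import numFieldNormedType.Exports.

Local Open Scope classical_set_scope.
Local Open Scope ring_scope.

(** Cut the unit cube by the grids of spacing 1 / (m 2^j), j = 0, 1, 2, ...
    A box [0, n/m) with n integral contains or avoids every m-cube entirely,
    so its discrepancy is 0 whatever the sample is.  Any other box is reached
    by rounding up: a grid point of level j + 1 has a parent at level j,
    obtained by halving its integer coordinates upwards, and the discrepancy
    of a box of level K is the sum of K increments along its ancestors.  The
    levels up to K with 4^K about m^(d-1) suffice, because moving from an
    arbitrary corner to that grid costs only d m^(d-1) / 2^K, which is at most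
    d M for M = sqrt (m^(d-1)) (star_discrepancy_le).

    An increment is a sum of independent centred indicators, and the sum V of
    their probabilities is N times the volume of a thin L-shaped set.  Both
    tails of the increment are controlled by its exponential moments, which are
    at most exp (2 lambda^2 V) for |lambda| <= 1 (integral_expR_le), the
    product formula for the moment being a finite expansion over the possible
    sets of points that fall in the L-shape (integral_prod_if).

    A union bound that treats all grid points alike would only give
    sqrt (ln m) instead of sqrt (ln (4em/d)).  The gain of the factor d inside
    the logarithm comes from weights.  If U is the sum over the coordinates of
    the distances from the corner to 1, then there are few corners with small
    U, and the corners with large U have small boxes, hence a small V: both V
    and V U are at most a constant times d m^(d-1) 2^(-j) (prodB_unit_le).  The
    failure probability allotted to a corner of level j is exp (-s) with
    s = d (L + j) + d U and L = ln (4em/d).  These probabilities sum to at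
    most 1 over a level (sum_weights_le1), while s V stays of order
    d^2 m^(d-1) 2^(-j) (L + j).  So every increment of level j is of order
    sqrt (s V), hence of order d M 2^(-j/2) sqrt (L + j), up to lower-order
    terms in s (threshold_le, level_excess).

    These bounds are summable in j: they add up to at most
    d M (12 sqrt L + 128) (chaining_total_le), and the rounding adds d M.  The
    claim follows, because sqrt (d m^d) / sqrt (m / d) = d M. *)

(** * Elementary inequalities *)

(** From expR (x / 2) <= 1 / (1 - x / 2), squared; the constant 2 in front of
    x ^+ 2 is what makes the comparison with a polynomial exact at x = 1. *)
Lemma expR_le_quad (R : realType) (x : R) : x <= 1 ->
  expR x <= 1 + x + 2 * x ^+ 2.
Proof.
move=> x1; pose y := x / 2; have -> : x = y * 2%:R by rewrite /y; field.
have y1 : y <= 1 / 2 by rewrite /y; lra.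
have c0 : 0 < 1 - y by lra.
have h1 : expR y <= (1 - y)^-1.
  have h := expR_ge1Dx (- y).
  by rewrite -[y in expR y]opprK expRN lef_pV2 ?posrE ?expR_gt0//; lra.
rewrite expRM_natr; apply: (@le_trans _ _ ((1 - y)^-1 ^+ 2)).
  by rewrite lerXn2r ?nnegrE ?expR_ge0 ?invr_ge0 ?(ltW c0).
rewrite exprVn -[leLHS]mul1r ler_pdivrMr ?exprn_gt0//.
have -> : (1 + y * 2 + 2 * (y * 2) ^+ 2) * (1 - y) ^+ 2 =
  1 + y ^+ 2 * ((1 - y * 2) * (5 - 4 * y)) by ring.
by rewrite lerDl mulr_ge0 ?sqr_ge0// mulr_ge0; lra.
Qed.

Lemma mulr_expRB_le1 (R : realType) (x : R) : x * expR (1 - x) <= 1.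
Proof.
have h := expR_ge1Dx (x - 1).
have -> : 1 - x = - (x - 1) by ring.
rewrite expRN ler_pdivrMr ?expR_gt0//; lra.
Qed.

(** Replacing the factors a by b one at a time changes the product by at most
    h times the product of the other c. *)
Lemma prodB_le (R : realFieldType) (I : Type) (r : seq I) (a b c : I -> R)
    (h : R) : 0 <= h ->
    (forall i, [/\ 0 <= a i, a i <= b i, b i <= c i & b i - a i <= h]) ->
    (forall i, 0 < c i) ->
  \prod_(i <- r) b i - \prod_(i <- r) a i <=
  \prod_(i <- r) c i * \sum_(i <- r) h / c i.
Proof.
move=> h0 abc c0; elim: r => [|i r IH]; first by rewrite !big_nil; lra.
rewrite !big_cons.
have [a0 ab bc bh] := abc i.
have cP : 0 <= \prod_(i <- r) c i by apply: prodr_ge0 => k _; exact: ltW.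
have bP : \prod_(i <- r) b i <= \prod_(i <- r) c i.
  by apply: ler_prod => k _; have [? ? ? _] := abc k; apply/andP; split; lra.
have abP : \prod_(i <- r) a i <= \prod_(i <- r) b i.
  by apply: ler_prod => k _; have [? ? ? _] := abc k; apply/andP; split; lra.
set A := \prod_(i <- r) a i in IH abP *.
set B := \prod_(i <- r) b i in IH bP abP *.
set C := \prod_(i <- r) c i in IH cP bP *; set S := \sum_(i <- r) _ in IH *.
have c0i := c0 i.
have -> : c i * C * (h / c i + S) = h * C + c i * (C * S) by field; lra.
have -> : b i * B - a i * A = (b i - a i) * B + a i * (B - A) by ring.
apply: lerD; last by apply: ler_pM => //; lra.
apply: ler_pM => //; first lra.
by apply: le_trans abP; apply: prodr_ge0 => k _; case: (abc k).
Qed.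

(** Read from the top end n = H, the terms are the powers of
    r = expR (- theta / H), and 1 - r >= theta / (2 H). *)
Lemma geo_sum_le (R : realType) (H : nat) (theta : R) :
    0 < theta -> theta <= H%:R ->
  \sum_(n < H.+1) expR (- (theta * (1 - n%:R / H%:R))) <= 2 * H%:R / theta.
Proof.
move=> t0 tH; have H0 : 0 < H%:R :> R by lra.
set x := theta / H%:R; have x0 : 0 < x by rewrite divr_gt0.
have x1 : x <= 1 by rewrite ler_pdivrMr// mul1r.
set r := expR (- x).
have r1 : r <= 1 - x / 2.
  rewrite /r expRN -[leLHS]mul1r ler_pdivrMr ?expR_gt0//.
  have : (1 - x / 2) * (1 + x) <= (1 - x / 2) * expR x.
    by apply: ler_wpM2l (expR_ge1Dx x); lra.
  have : 0 <= x * (1 - x) by rewrite mulr_ge0//; lra.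
  lra.
have r0 : 0 < r by exact: expR_gt0.
rewrite (reindex_inj rev_ord_inj)/=.
rewrite (eq_bigr (fun n : 'I_H.+1 => r ^+ n)); last first.
  move=> n _; rewrite /r -expRM_natr subSS natrB; last by rewrite -ltnS.
  by congr expR; rewrite /x; field; rewrite gt_eqF.
have hg : (1 - r) * \sum_(n < H.+1) r ^+ n <= 1.
  by rewrite -opprB mulNr -subrX1; have := exprn_gt0 H.+1 r0; lra.
have -> : 2 * H%:R / theta = (x / 2)^-1 by rewrite /x; field; lra.
have S0 : 0 <= \sum_(n < H.+1) r ^+ n.
  by apply: sumr_ge0 => n _; rewrite exprn_ge0// ltW.
by rewrite -[leRHS]mul1r ler_pdivlMr; nra.
Qed.

(** The ratio 3 / 4 serves as a rational upper bound for sqrt (1 / 2). *)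
Lemma sum_geo34 (R : realFieldType) (K : nat) (c : R) : 0 <= c ->
  \sum_(j < K) (c + j.+1%:R) * (3 / 4) ^+ j.+1 <= 3 * c + 12 :> R.
Proof.
move=> c0.
suff -> : \sum_(j < K) (c + j.+1%:R) * (3 / 4) ^+ j.+1 =
    3 * c + 12 - (3 * c + 12 + 3 * K%:R) * (3 / 4) ^+ K :> R.
  have : 0 <= (3 / 4) ^+ K :> R by rewrite exprn_ge0//; lra.
  have : 0 <= K%:R :> R by []; nra.
elim: K => [|K IH]; first by rewrite big_ord0 expr0; ring.
by rewrite big_ord_recr/= IH exprS -[K.+1]addn1 natrD; field.
Qed.

(** * Exponential moments of independent indicators *)

Lemma prod_indicator (R : realType) (T : Type) (I : finType) (F : I -> set T)
    (w : T) :
  \prod_c (w \in F c)%:R = \1_(\bigcap_(c in [set` [set: I]%SET]) F c) w :> R.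
Proof.
rewrite indicE; case: (boolP (w \in _)) => h.
  rewrite big1// => c _; move/set_mem: h => /(_ c) h.
  by rewrite mem_set//; apply: h; rewrite /= inE.
have [c wc] : exists c, w \notin F c.
  apply/existsP; rewrite -negb_forall; apply: contra h => /forallP h.
  by rewrite mem_set// => c _; apply: set_mem.
by rewrite (bigD1 c)//= (negbTE wc) mul0r.
Qed.

Lemma measurable_bigcap_preimage (dO dE : measure_display)
    (Omega : measurableType dO) (E : measurableType dE) (I : finType)
    (X : I -> {mfun Omega >-> E}) (A : I -> set E) :
  (forall c, measurable (A c)) ->
  measurable (\bigcap_(c in [set` [set: I]%SET]) X c @^-1` A c).
Proof.
move=> mA; apply: fin_bigcap_measurable; first exact: finite_finset.
by move=> c _; exact: measurable_funPTI.
Qed.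

Lemma measurable_sum_mem (dO dE : measure_display)
    (Omega : measurableType dO) (E : measurableType dE) (R : realType)
    (I : finType) (X : I -> {mfun Omega >-> E}) (B : set E) (mB : measurable B) :
  measurable_fun setT (fun w => \sum_c (X c w \in B)%:R : R).
Proof.
apply: (@eq_measurable_fun _ _ _ _ setT (fun w => \sum_c \1_(X c @^-1` B) w : R)).
  by move=> w _; apply: eq_bigr => c _; rewrite indicE.
apply: measurable_sum => c; apply: measurable_indic.
exact: measurable_funPTI.
Qed.

(** The family of events [X c in B] takes one of finitely many patterns J, and
    independence, applied to B for c in J and to its complement for the other
    c, gives the probability of each pattern.  Writing the integrand as a
    nonnegative combination of the indicators of the patterns keeps all the
    integrals nonnegative. *)
Lemma integral_prod_if (dO dE : measure_display)
    (Omega : measurableType dO) (E : measurableType dE) (R : realType)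
    (Pr : probability Omega R) (I : finType) (X : I -> {mfun Omega >-> E})
    (indep : mutually_independent Pr (fun c => X c : Omega -> E))
    (B : set E) (mB : measurable B) (a b : I -> R) :
    (forall c, 0 <= a c) -> (forall c, 0 <= b c) ->
  (\int[Pr]_w (\prod_c (if X c w \in B then a c else b c))%:E =
   (\prod_c (a c * fine (Pr (X c @^-1` B)) +
             b c * (1 - fine (Pr (X c @^-1` B)))))%:E)%E.
Proof.
move=> a0 b0; pose A (J : {set I}) c := if c \in J then B else ~` B.
pose F J := \bigcap_(c in [set` [set: I]%SET]) X c @^-1` A J c.
pose k (J : {set I}) := \prod_c (if c \in J then a c else b c).
have mA J c : measurable (A J c).
  by rewrite /A; case: ifP => _ //; exact: measurableC.
have mX C c : measurable C -> measurable (X c @^-1` C).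
  by move=> mC; exact: measurable_funPTI.
have mF J : measurable (F J) by exact: measurable_bigcap_preimage.
have k0 J : 0 <= k J by apply: prodr_ge0 => c _; case: ifP.
(* Expand the product over c of a [X c in B] + b [X c not in B]. *)
have expand w : \prod_c (if X c w \in B then a c else b c) =
    \sum_J k J * \1_(F J) w.
  transitivity (\prod_c (a c * (X c w \in B)%:R + b c * (X c w \in ~` B)%:R)).
    apply: eq_bigr => c _; rewrite in_setC.
    by case: (X c w \in B); rewrite /= !(mulr0, mulr1) ?addr0 ?add0r.
  rewrite bigA_distr; apply: eq_bigr => J _.
  rewrite -prod_indicator /k -big_split/=; apply: eq_bigr => c _.
  by rewrite /A; case: ifP.
under eq_integral do rewrite expand -sumEFin.
rewrite ge0_integral_sum//=; last 2 first.
- move=> J; apply/measurable_EFinP; apply: measurable_funM => //.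
- by move=> J w _; rewrite lee_fin mulr_ge0.
transitivity (\sum_J (k J * \prod_c fine (Pr (X c @^-1` A J c)))%:E)%E.
  apply: eq_bigr => J _; under eq_integral do rewrite EFinM.
  rewrite ge0_integralZl_EFin//; last by apply/measurable_EFinP.
  rewrite integral_indic// setIT EFinM; congr (_ * _)%E.
  apply: etrans (indep [set: I]%SET _ (mA J)) _.
  rewrite -prodEFin; apply: eq_big => [c|c _]; first by rewrite inE.
  by rewrite fineK//; apply: fin_num_measure; apply: mX.
rewrite sumEFin; congr EFin; rewrite bigA_distr; apply: eq_bigr => J _.
rewrite /k -big_split/=; apply: eq_bigr => c _.
rewrite /A; case: ifP => // _; congr (_ * _).
rewrite preimage_setC probability_setC; last exact: mX.
by rewrite fineB//; apply: fin_num_measure; apply: mX.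
Qed.

(** Bernstein-type bound for both signs of lambda: the variance proxy V is the
    sum of the probabilities, not the number of indicators, and this is what
    makes finer levels of the chain contribute less. *)
Lemma integral_expR_le (dO dE : measure_display)
    (Omega : measurableType dO) (E : measurableType dE) (R : realType)
    (Pr : probability Omega R) (I : finType) (X : I -> {mfun Omega >-> E})
    (indep : mutually_independent Pr (fun c => X c : Omega -> E))
    (B : set E) (mB : measurable B) (lambda : R) (hl : `|lambda| <= 1)
    (V : R) (VE : V = \sum_c fine (Pr (X c @^-1` B))) :
  (\int[Pr]_w (expR (lambda * (\sum_c (X c w \in B)%:R - V)))%:E <=
   (expR (2 * lambda ^+ 2 * V))%:E)%E.
Proof.
pose p c := fine (Pr (X c @^-1` B)).
have prodE w : expR (lambda * (\sum_c (X c w \in B)%:R - V)) =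
    expR (- (lambda * V)) * \prod_c (if X c w \in B then expR lambda else 1).
  rewrite mulrBr expRD mulrC; congr (_ * _).
  rewrite mulr_sumr expR_sum; apply: eq_bigr => c _.
  by case: ifP; rewrite ?mulr1// mulr0 expR0.
under eq_integral do rewrite prodE EFinM.
have p01 c : 0 <= p c <= 1.
  have h : (Pr (X c @^-1` B) <= 1)%E.
    by apply: probability_le1; exact: measurable_funPTI.
  rewrite fine_ge0//= -[leRHS]/(fine 1%E) fine_le// fin_num_measure//.
  exact: measurable_funPTI.
rewrite ge0_integralZl_EFin//; last 2 first.
- move=> w _; rewrite lee_fin; apply: prodr_ge0 => c _.
  by case: ifP; rewrite ?expR_ge0.
- apply/measurable_EFinP.
  apply: (eq_measurable_fun
    (fun w => expR (lambda * \sum_c (X c w \in B)%:R))).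
    move=> w _; rewrite mulr_sumr expR_sum; apply: eq_bigr => c _.
    by case: ifP; rewrite ?mulr1// mulr0 expR0.
  apply: (measurableT_comp (@measurable_expR R)); apply: measurable_funM => //.
  exact: measurable_sum_mem.
rewrite (integral_prod_if indep)//.
rewrite -EFinM lee_fin.
have -> : 2 * lambda ^+ 2 * V =
  - (lambda * V) + (lambda + 2 * lambda ^+ 2) * V by ring.
rewrite expRD ler_wpM2l ?expR_ge0// VE.
rewrite mulr_sumr expR_sum; apply: ler_prod => c _.
have /andP[pc0 pc1] := p01 c; rewrite -/(p c); have e0 := expR_ge0 lambda.
apply/andP; split; first by rewrite addr_ge0// mulr_ge0//; lra.
apply: le_trans (expR_ge1Dx _).
have := @expR_le_quad R lambda; rewrite (le_trans (ler_norm _) hl) => /(_ isT) h.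
have := ler_wpM2r pc0 h; lra.
Qed.

(** Immediate from the definition of the integral as a supremum over simple
    functions; this spares a proof that the star discrepancy, a supremum over
    uncountably many boxes, is measurable. *)
Lemma le_integral_ge0 (dO : measure_display) (Omega : measurableType dO)
    (R : realType) (mu : {measure set Omega -> \bar R}) (f g : Omega -> \bar R) :
    (forall w, (0 <= f w)%E) -> (forall w, (f w <= g w)%E) ->
  (\int[mu]_w f w <= \int[mu]_w g w)%E.
Proof.
move=> f0 fg; have g0 w : (0 <= g w)%E by exact: le_trans (f0 w) (fg w).
rewrite !ge0_integralTE//; apply: ereal_sup_le => _ [h hf <-].
by exists h => // w; apply: le_trans (hf w) (fg w).
Qed.

(** * Discrepancy of anchored boxes under jittered sampling *)

Lemma measurable_box (R : realType) (d : nat) (a b : 'I_d -> R) :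
  measurable (box a b).
Proof.
have -> : box a b = \bigcap_(i in [set` [set: 'I_d]%SET])
    ((@tnth d R)^~ i @^-1` `[a i, b i[%classic).
  apply/seteqP; split=> y /= h i.
    by move=> _ /=; rewrite in_itv/=; exact: h.
  by have := h i; rewrite /= in_itv/= inE; exact.
apply: fin_bigcap_measurable; first exact: finite_finset.
move=> i _; rewrite -[X in measurable X]setTI.
by apply: measurable_tnth => //; exact: measurable_itv.
Qed.

Lemma sum_tuple_prod (R : comPzRingType) (m d : nat) (F : 'I_d -> 'I_m -> R) :
  \sum_(c : d.-tuple 'I_m) \prod_(i < d) F i (tnth c i) =
  \prod_(i < d) \sum_(k < m) F i k.
Proof.
rewrite bigA_distr_bigA/=.
rewrite (reindex (fun f : {ffun 'I_d -> 'I_m} => [tuple f i | i < d])).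
  by apply: eq_bigr => f _; apply: eq_bigr => i _; rewrite tnth_mktuple.
exists (fun c : d.-tuple 'I_m => [ffun i => tnth c i]) => f _.
  by apply/ffunP => i; rewrite ffunE tnth_mktuple.
by apply: eq_from_tnth => i; rewrite tnth_mktuple ffunE.
Qed.

(** The summand is the length of [0, y) in the k-th of m equal intervals, which
    is a difference of consecutive values of min (y, k / m). *)
Lemma sum_clamp (R : realFieldType) (m : nat) (y : R) :
    (0 < m)%N -> 0 <= y <= 1 ->
  \sum_(k < m) (Num.max (k%:R / m%:R) (Num.min y (k%:R / m%:R + m%:R^-1))
                - k%:R / m%:R) = y.
Proof.
move=> m0 /andP[y0 y1]; have m0' : 0 < m%:R :> R by rewrite ltr0n.
pose f (k : nat) : R := Num.min y (k%:R / m%:R).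
transitivity (\sum_(0 <= k < m) (f k.+1 - f k)).
  rewrite big_mkord; apply: eq_bigr => k _; rewrite /f -natr1 mulrDl mul1r.
  have : 0 < m%:R^-1 :> R by rewrite invr_gt0.
  set u := (nat_of_ord k)%:R / _; set v := _^-1 => v0.
  rewrite /Num.max /Num.min; do ?case: ifPn; rewrite -?leNgt => *; lra.
rewrite telescope_sumr// /f mul0r divff ?gt_eqF//.
by rewrite (min_idPl y1) (min_idPr y0) subr0.
Qed.

(** The outer maximum makes the side empty, rather than negative, when y lies
    to the left of the cube. *)
Lemma anchored_cube (R : realType) (m d : nat) (y : 'I_d -> R)
    (c : d.-tuple 'I_m) :
  box (fun=> 0) y `&` m_cube c =
  box (fun i => (tnth c i)%:R / m%:R)
      (fun i => Num.max ((tnth c i)%:R / m%:R)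
                 (Num.min (y i) ((tnth c i)%:R / m%:R + m%:R^-1))).
Proof.
apply/seteqP; split=> [t [/= h1 h2] i|t /= h].
  have /andP[_ t_lt] := h1 i; have /andP[-> t_lt'] := h2 i.
  by rewrite lt_max lt_min t_lt t_lt' orbT.
have {}h i : [/\ (tnth c i)%:R / m%:R <= tnth t i, tnth t i < y i &
    tnth t i < (tnth c i)%:R / m%:R + m%:R^-1].
  have /andP[ct] := h i; rewrite lt_max ltNge ct/= lt_min => /andP[ty tc].
  by split.
split=> i; have [ct ty tc] := h i; last by rewrite ct.
by rewrite ty andbT (le_trans _ ct)// divr_ge0.
Qed.

Definition box_count (R : realType) (m d : nat) (dO : measure_display)
    (Omega : measurableType dO) (Pr : probability Omega R)
    (X : d.-tuple 'I_m -> {RV Pr >-> d.-tuple R})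
    (y : 'I_d -> R) (w : Omega) : R :=
  \sum_c (X c w \in box (fun=> 0) y)%:R.

Definition box_disc (R : realType) (m d : nat) (dO : measure_display)
    (Omega : measurableType dO) (Pr : probability Omega R)
    (X : d.-tuple 'I_m -> {RV Pr >-> d.-tuple R})
    (y : 'I_d -> R) (w : Omega) : R :=
  box_count X y w - m%:R ^+ d * \prod_(i < d) y i.

Lemma prob_mem_box (R : realType) (m d : nat) (dO : measure_display)
    (Omega : measurableType dO) (Pr : probability Omega R)
    (X : d.-tuple 'I_m -> {RV Pr >-> d.-tuple R}) (y : 'I_d -> R)
    (c : d.-tuple 'I_m) : (0 < m)%N -> uniform_on (m_cube c) (X c) ->
  fine (Pr (X c @^-1` box (fun=> 0) y)) =
  \prod_(i < d) (m%:R * (Num.max ((tnth c i)%:R / m%:R)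
      (Num.min (y i) ((tnth c i)%:R / m%:R + m%:R^-1)) - (tnth c i)%:R / m%:R)).
Proof.
move=> m0 /(_ _ (measurable_box (fun=> 0) y)) h.
have m0' : 0 < m%:R :> R by rewrite ltr0n.
have := congr1 fine h; rewrite /distribution /pushforward/= => ->.
rewrite anchored_cube lebesgue_tuple_box; last by move=> i; rewrite le_max lexx.
rewrite lebesgue_tuple_box/=; last by move=> i; rewrite lerDl invr_ge0 ltW.
rewrite -prodf_div; apply: eq_bigr => i _.
rewrite addrAC subrr add0r invrK mulrC; congr (_ * _).
Qed.

(** Jittered sampling is unbiased: by the product form of the probabilities the
    sum over the cubes factors over the coordinates. *)
Lemma sum_prob_mem_box (R : realType) (m d : nat) (dO : measure_display)
    (Omega : measurableType dO) (Pr : probability Omega R)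
    (X : d.-tuple 'I_m -> {RV Pr >-> d.-tuple R}) (y : 'I_d -> R) :
    (0 < m)%N -> (forall c, uniform_on (m_cube c) (X c)) ->
    (forall i, 0 <= y i <= 1) ->
  \sum_c fine (Pr (X c @^-1` box (fun=> 0) y)) =
  m%:R ^+ d * \prod_(i < d) y i.
Proof.
move=> m0 unif y01; under eq_bigr do rewrite prob_mem_box//.
rewrite (sum_tuple_prod (fun i k => m%:R * (Num.max (k%:R / m%:R)
  (Num.min (y i) (k%:R / m%:R + m%:R^-1)) - k%:R / m%:R))).
have -> : m%:R ^+ d = \prod_(i < d) m%:R :> R by rewrite prodr_const card_ord.
rewrite -big_split/=.
by apply: eq_bigr => i _; rewrite -mulr_sumr sum_clamp.
Qed.

(** The cubes inside such a box are known in advance, so each event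
    [X c in box] is either certain or impossible, and the count equals its own
    expectation. *)
Lemma box_disc_grid (R : realType) (m d : nat) (dO : measure_display)
    (Omega : measurableType dO) (Pr : probability Omega R)
    (X : d.-tuple 'I_m -> {RV Pr >-> d.-tuple R}) (q : 'I_d -> nat) w :
    (0 < m)%N -> (forall c w, m_cube c (X c w)) ->
    (forall c, uniform_on (m_cube c) (X c)) -> (forall i, (q i <= m)%N) ->
  box_disc X (fun i => (q i)%:R / m%:R) w = 0.
Proof.
move=> m0 inC unif qm; have m0' : 0 < m%:R :> R by rewrite ltr0n.
rewrite /box_disc -(sum_prob_mem_box (X := X))//; last first.
  by move=> i; rewrite divr_ge0//= ler_pdivrMr// mul1r ler_nat.
apply/eqP; rewrite subr_eq0; apply/eqP; apply: eq_bigr => c _.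
set B := box _ _.
have memB w' : (X c w' \in B) = [forall i, (tnth c i < q i)%N].
  apply/idP/forallP => [/set_mem h i|h].
    have /andP[_ h1] := h i; have /andP[h2 _] := inC c w' i.
    have := le_lt_trans h2 h1.
    by rewrite ltr_pM2r ?invr_gt0// ltr_nat.
  apply/mem_set => i; have /andP[h1 h2] := inC c w' i.
  rewrite (le_trans _ h1) ?divr_ge0//=; apply: (lt_le_trans h2).
  by rewrite -[X in _ + X]mul1r -mulrDl ler_pM2r ?invr_gt0// natr1 ler_nat; exact: h.
rewrite memB; case: (boolP [forall i, _]) => hc.
  rewrite (_ : X c @^-1` B = setT) ?probability_setT//.
  by apply/seteqP; split=> // w' _; have := memB w'; rewrite hc => /set_mem.
rewrite (_ : X c @^-1` B = set0) ?measure0//.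
by apply/seteqP; split=> // w' wB; have := memB w'; rewrite (negbTE hc) mem_set.
Qed.

(** Distinct cubes are disjoint, so the sample has exactly m ^ d points and
    they can be counted through their cubes. *)
Lemma disc_anchored_box (R : realType) (m d : nat) (dO : measure_display)
    (Omega : measurableType dO) (Pr : probability Omega R)
    (X : d.-tuple 'I_m -> {RV Pr >-> d.-tuple R}) (x : d.-tuple R) w :
    (0 < m)%N -> (forall c w, m_cube c (X c w)) -> (forall i, 0 <= tnth x i) ->
  disc (jittered_point_set X w) (anchored_box x) = box_disc X (tnth x) w.
Proof.
move=> m0 inC x0; have m0' : 0 < m%:R :> R by rewrite ltr0n.
have injX : injective (X^~ w).
  move=> c c' cc'; apply: eq_from_tnth => i; apply/val_inj/eqP.
  have /andP[h1 h2] := inC c w i; have /andP[h3 h4] := inC c' w i.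
  rewrite -cc' in h3 h4; have := le_lt_trans h1 h4; have := le_lt_trans h3 h2.
  rewrite -[X in _ + X]mul1r -mulrDl ltr_pM2r ?invr_gt0// natr1 ltr_nat ltnS.
  rewrite -[X in _ + X]mul1r -mulrDl ltr_pM2r ?invr_gt0// natr1 ltr_nat ltnS.
  by move=> *; rewrite eqn_leq; apply/andP.
rewrite /disc /box_disc lebesgue_tuple_box//=; congr (_ - _ * _); last 2 first.
- rewrite card_imfset//= -natrX; congr _%:R.
  by rewrite -cardE card_tuple card_ord.
- by apply: eq_bigr => i _; rewrite subr0.
rewrite /box_count -natr_sum; congr _%:R.
rewrite card_fset_sum1 -big_fset_condE big_mkcond big_imfset//=; last first.
  by move=> c c' _ _; exact: injX.
by rewrite big_enum/=; apply: eq_bigr => c _; case: (_ \in _).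
Qed.

Lemma box_count_le (R : realType) (m d : nat) (dO : measure_display)
    (Omega : measurableType dO) (Pr : probability Omega R)
    (X : d.-tuple 'I_m -> {RV Pr >-> d.-tuple R}) (a b : 'I_d -> R) w :
  (forall i, a i <= b i) -> box_count X a w <= box_count X b w.
Proof.
move=> ab; apply: ler_sum => c _; rewrite ler_nat.
case: (boolP (_ \in box _ a)) => // /set_mem ha.
rewrite mem_set// => i; have /andP[-> h] := ha i.
exact: lt_le_trans h (ab i).
Qed.

(** Both the count and the volume are monotone in the corner. *)
Lemma box_disc_bracket (R : realType) (m d : nat) (dO : measure_display)
    (Omega : measurableType dO) (Pr : probability Omega R)
    (X : d.-tuple 'I_m -> {RV Pr >-> d.-tuple R}) (a x b : 'I_d -> R) w
    (t e : R) :
    (forall i, [/\ 0 <= a i, a i <= x i & x i <= b i]) ->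
    `|box_disc X a w| <= t -> `|box_disc X b w| <= t ->
    m%:R ^+ d * (\prod_(i < d) b i - \prod_(i < d) a i) <= e ->
  `|box_disc X x w| <= t + e.
Proof.
move=> axb; rewrite !ler_norml /box_disc => /andP[a1 a2] /andP[b1 b2] h.
have ax : box_count X a w <= box_count X x w.
  by apply: box_count_le => i; case: (axb i).
have xb : box_count X x w <= box_count X b w.
  by apply: box_count_le => i; case: (axb i).
have pax : m%:R ^+ d * \prod_(i < d) a i <= m%:R ^+ d * \prod_(i < d) x i.
  apply: ler_wpM2l; first exact: exprn_ge0.
  by apply: ler_prod => i _; case: (axb i) => -> ->.
have pxb : m%:R ^+ d * \prod_(i < d) x i <= m%:R ^+ d * \prod_(i < d) b i.
  apply: ler_wpM2l; first exact: exprn_ge0.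
  by apply: ler_prod => i _; case: (axb i) => h1 h2 ->; rewrite (le_trans h1).
apply/andP; split; lra.
Qed.

(** The increment is a centred sum because the expected count of each box is
    m ^ d times its volume. *)
Lemma box_disc_increment (R : realType) (m d : nat) (dO : measure_display)
    (Omega : measurableType dO) (Pr : probability Omega R)
    (X : d.-tuple 'I_m -> {RV Pr >-> d.-tuple R}) (a b : 'I_d -> R) :
    (0 < m)%N -> (forall c, uniform_on (m_cube c) (X c)) ->
    (forall i, [/\ 0 <= a i, a i <= b i & b i <= 1]) ->
  let B := box (fun=> 0) b `\` box (fun=> 0) a in
  let V := m%:R ^+ d * (\prod_(i < d) b i - \prod_(i < d) a i) in
  V = \sum_c fine (Pr (X c @^-1` B)) /\
  forall w, box_disc X b w - box_disc X a w = \sum_c (X c w \in B)%:R - V.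
Proof.
move=> m0 unif ab B V.
have sub : box (fun=> 0) a `<=` box (fun=> 0) b.
  move=> t h i; have /andP[-> h1] := h i; apply: lt_le_trans h1 _.
  by case: (ab i).
have mX c y : measurable (X c @^-1` box (fun=> 0) y).
  by apply: measurable_funPTI; exact: measurable_box.
split=> [|w].
  rewrite /V mulrBr -!(sum_prob_mem_box (X := X))//; last 2 first.
  - by move=> i; case: (ab i) => *; apply/andP; split=> //; lra.
  - by move=> i; case: (ab i) => *; apply/andP; split=> //; lra.
  rewrite -sumrB; apply: eq_bigr => c _; rewrite -fineB ?fin_num_measure//.
  have -> : X c @^-1` B =
    X c @^-1` box (fun=> 0) b `\` X c @^-1` box (fun=> 0) a by [].
  congr fine; rewrite measureD//; last first.
    exact: le_lt_trans (probability_le1 _ (mX _ _)) (ltry _).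
  rewrite setIidr//; exact: preimage_subset.
transitivity (box_count X b w - box_count X a w - V).
  by rewrite /box_disc /V; ring.
rewrite /box_count -sumrB; congr (_ + _); apply: eq_bigr => c _; rewrite /B in_setD.
case: (boolP (X c w \in box _ a)) => ha; last by rewrite subr0 andbT.
by rewrite andbF mem_set ?subrr//; apply/sub/set_mem.
Qed.

(** * Deviation of one increment *)

(** Instead of a tail bound, the estimate is kept pointwise: the increment
    exceeds its threshold by at most a random variable Z of tiny expectation.
    Summing Z over all the increments of a level then replaces the union bound.
    Here Z is the sum over both signs of
    expR (lambda (+- D - t)) / lambda, from y <= expR y. *)
Lemma increment_excess (R : realType) (m d : nat) (dO : measure_display)
    (Omega : measurableType dO) (Pr : probability Omega R)
    (X : d.-tuple 'I_m -> {RV Pr >-> d.-tuple R}) (hX : jittered_sampling X)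
    (a b : 'I_d -> R) (s : R) :
    (0 < m)%N -> 1 <= s ->
    (forall i, [/\ 0 <= a i, a i <= b i & b i <= 1]) ->
  let V := m%:R ^+ d * (\prod_(i < d) b i - \prod_(i < d) a i) in
  exists Z : Omega -> R, [/\ measurable_fun setT Z, forall w, 0 <= Z w,
    forall w, `|box_disc X b w - box_disc X a w| <=
              2 * Num.sqrt (s * (2 * V + s)) + Z w &
    (\int[Pr]_w (Z w)%:E <= (2 * (1 + Num.sqrt (2 * V)) * expR (- s))%:E)%E].
Proof.
case: hX => _ unif indep m0 s1 ab V.
have [VE DE] := box_disc_increment m0 unif ab.
set B := _ `\` _ in VE DE; rewrite -/V in VE DE.
have mB : measurable B by apply: measurableD; exact: measurable_box.
have V0 : 0 <= V.
  rewrite /V mulr_ge0 ?exprn_ge0// subr_ge0; apply: ler_prod => i _.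
  by case: (ab i) => -> ->.
(* lam minimises lam (2 V + s) + s / lam, and t is the minimum. *)
set lam := Num.sqrt (s / (2 * V + s)).
set t := 2 * Num.sqrt (s * (2 * V + s)).
have lam0 : 0 < lam by rewrite sqrtr_gt0 divr_gt0//; lra.
have lam1 : lam <= 1.
  rewrite /lam -[leRHS]sqrtr1 ler_sqrt// ler_pdivrMr; lra.
have lamt : lam * t = 2 * s.
  rewrite /lam /t mulrCA -sqrtrM; last by rewrite divr_ge0//; lra.
  have -> : s / (2 * V + s) * (s * (2 * V + s)) = s ^+ 2 by field; lra.
  by rewrite sqrtr_sqr ger0_norm//; lra.
have lam2V : 2 * lam ^+ 2 * V <= s.
  rewrite /lam sqr_sqrtr; last by rewrite divr_ge0//; lra.
  have -> : 2 * (s / (2 * V + s)) * V = s * (2 * V / (2 * V + s)) by field; lra.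
  rewrite -[leRHS]mulr1 ler_wpM2l//; first by lra.
  by rewrite ler_pdivrMr; lra.
have lamV : lam^-1 <= 1 + Num.sqrt (2 * V).
  have q0 : 0 <= Num.sqrt (2 * V) by [].
  rewrite /lam -sqrtrV; last by rewrite divr_ge0//; lra.
  rewrite invfM invrK mulrC.
  apply: (@le_trans _ _ (Num.sqrt ((1 + Num.sqrt (2 * V)) ^+ 2))).
    rewrite ler_sqrt ?sqr_ge0// ler_pdivrMr; last by lra.
    have := sqr_sqrtr (_ : 0 <= 2 * V); set q := Num.sqrt _ in q0 *.
    move=> qE; have {}qE : q ^+ 2 = 2 * V by apply: qE; lra.
    rewrite -qE.
    have : 0 <= q * s by rewrite mulr_ge0//; lra.
    have : q ^+ 2 <= q ^+ 2 * s by rewrite ler_peMr// sqr_ge0.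
    lra.
  by rewrite sqrtr_sqr ger0_norm//; lra.
pose D w := \sum_c (X c w \in B)%:R - V : R.
have mD : measurable_fun setT D.
  by apply: measurable_funB => //; exact: measurable_sum_mem.
pose e (u : R) w := expR (u * D w) * (lam^-1 * expR (- (lam * t))).
have me u : measurable_fun setT (e u).
  apply: measurable_funM => //; apply: (measurableT_comp (@measurable_expR R)).
  exact: measurable_funM.
have k0 : 0 <= lam^-1 * expR (- (lam * t)).
  by rewrite mulr_ge0 ?expR_ge0// invr_ge0 ltW.
have e0 u w : 0 <= e u w by rewrite mulr_ge0// expR_ge0.
have eI u : `|u| = lam -> (\int[Pr]_w (e u w)%:E <= (lam^-1 * expR (- s))%:E)%E.
  move=> ul; under eq_integral do rewrite /e mulrC EFinM.
  rewrite ge0_integralZl_EFin//; last first.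
    apply/measurable_EFinP; apply: (measurableT_comp (@measurable_expR R)).
    exact: measurable_funM.
  have ul1 : `|u| <= 1 by rewrite ul.
  apply: le_trans (lee_wpmul2l _ (integral_expR_le indep mB ul1 VE)) _.
    by rewrite lee_fin.
  rewrite -EFinM lee_fin -[leLHS]mulrA -expRD ler_wpM2l ?invr_ge0 ?(ltW lam0)//.
  by rewrite ler_expR lamt -[u ^+ 2]real_normK ?num_real// ul; lra.
exists (fun w => e lam w + e (- lam) w); split=> [|w|w|].
- exact: measurable_funD.
- by rewrite addr_ge0.
- rewrite DE -/(D w) -/t.
  have key u : u * D w <= lam * t + lam * e u w.
    have -> : lam * e u w = expR (u * D w) * expR (- (lam * t)).
      by rewrite /e; field; rewrite gt_eqF.
    rewrite -expRD.
    have := expR_ge1Dx (u * D w + - (lam * t)); lra.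
  have h1 := e0 lam w; have h2 := e0 (- lam) w.
  rewrite ler_norml; apply/andP; split.
    rewrite -(ler_pM2l lam0); have := key (- lam).
    have : 0 <= lam * e lam w by rewrite mulr_ge0// ltW.
    lra.
  rewrite -(ler_pM2l lam0); have := key lam.
  have : 0 <= lam * e (- lam) w by rewrite mulr_ge0// ltW.
  lra.
under eq_integral do rewrite EFinD.
rewrite ge0_integralD//; last 4 first.
- by move=> w _; rewrite lee_fin.
- by apply/measurable_EFinP.
- by move=> w _; rewrite lee_fin.
- by apply/measurable_EFinP.
apply: (@le_trans _ _ ((lam^-1 * expR (- s))%:E + (lam^-1 * expR (- s))%:E)%E).
  by apply: leeD; apply: eI; rewrite ?normrN gtr0_norm.
by rewrite -EFinD lee_fin; have := ler_wpM2r (expR_ge0 (- s)) lamV; lra.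
Qed.

(** The first bound compares b with 1.  The second one exploits that
    b <= 1 - u + h <= expR (- u + h) with u = 1 - a, so the difference is of
    order d h expR (- U), and U expR (1 - U) <= 1. *)
Lemma prodB_unit_le (R : realType) (d : nat) (a b : 'I_d -> R) (h : R) :
    (0 < d)%N -> 0 <= h -> d%:R * h <= 1 ->
    (forall i, [/\ 0 <= a i, a i <= b i, b i <= 1 & b i - a i <= h]) ->
  let V := \prod_(i < d) b i - \prod_(i < d) a i in
  V <= d%:R * h /\ V * (\sum_(i < d) (1 - a i)) <= 4 * (d%:R * h).
Proof.
move=> d0 h0 dh ab V; set U := \sum_(i < d) _.
have U0 : 0 <= U.
  by apply: sumr_ge0 => i _; case: (ab i) => *; lra.
split.
  apply: le_trans (@prodB_le R 'I_d _ a b (fun=> 1) h h0 _ _) _ => //.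
  rewrite big1// mul1r.
  by under eq_bigr do rewrite divr1; rewrite sumr_const card_ord mulr_natl.
have h1 : h <= 1 by apply: le_trans dh; rewrite ler_peMl// ler1n.
pose c i := expR (- (1 - a i) + h).
have Vle : V <= \prod_(i < d) c i * \sum_(i < d) h / c i.
  apply: prodB_le => // i; last exact: expR_gt0.
  case: (ab i) => a0 aleb b1 bah; split=> //.
  by rewrite /c; have := expR_ge1Dx (- (1 - a i) + h); lra.
have prodc : \prod_(i < d) c i <= expR (1 - U).
  rewrite -expR_sum ler_expR big_split/= sumrN -/U sumr_const card_ord -mulr_natl.
  lra.
have sumc : \sum_(i < d) h / c i <= d%:R * h * 4.
  rewrite -mulrA mulr_natl -[X in _ *+ X](card_ord d) -sumr_const.
  apply: ler_sum => i _; rewrite ler_wpM2l// /c -expRN.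
  have e4 : expR 1 <= 4 :> R by have := @expR_le_quad R 1; lra.
  apply: le_trans e4; rewrite ler_expR; case: (ab i) => *; lra.
have V' : V <= expR (1 - U) * (d%:R * h * 4).
  apply: le_trans Vle _; apply: ler_pM => //.
    by apply: prodr_ge0 => i _; exact: expR_ge0.
  by apply: sumr_ge0 => i _; rewrite divr_ge0// expR_ge0.
apply: (@le_trans _ _ (expR (1 - U) * (d%:R * h * 4) * U)); first by rewrite ler_wpM2r.
have := mulr_expRB_le1 U.
have : 0 <= d%:R * h * 4 by rewrite !mulr_ge0.
nra.
Qed.

(** To be used with p = 2 ^ (- j) and r an upper bound for its square root.
    The product V s splits into V (L + j) and V U, and both are controlled by
    the size d M^2 p of the level; the remaining s under the root is what
    Bernstein's inequality costs beyond the Gaussian regime. *)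
Lemma threshold_le (R : realType) (d : nat) (M L U V s p r : R) (j : nat) :
    (0 < d)%N -> 0 <= M -> 0 <= V -> 0 <= U -> U <= d%:R -> 1 <= L -> 0 <= r ->
    p <= r ^+ 2 ->
    V <= d%:R * M ^+ 2 * p -> V * U <= 4 * (d%:R * M ^+ 2 * p) ->
    s = d%:R * (L + j%:R) + d%:R * U ->
  2 * Num.sqrt (s * (2 * V + s)) <=
    2 * d%:R * M * r * (2 * Num.sqrt L + 5 + j%:R) + 2 * d%:R * (L + j%:R + d%:R).
Proof.
move=> d0 M0 V0 U0 Ud L1 r0 pr Vle VUle sE.
have d1 : 1 <= d%:R :> R by rewrite ler1n.
have j0 : 0 <= j%:R :> R by [].
have q0 : 0 <= Num.sqrt L by [].
have qE : Num.sqrt L ^+ 2 = L by rewrite sqr_sqrtr//; lra.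
set q := Num.sqrt L in q0 qE *.
have Lj : 0 <= L + j%:R by lra.
have s0 : 0 <= s by rewrite sE -mulrDr mulr_ge0//; lra.
set A := d%:R * M * r * (2 * q + 5 + j%:R).
have A0 : 0 <= A by rewrite /A !mulr_ge0//; lra.
have VsA : 2 * V * s <= A ^+ 2.
  have h1 : V * (L + j%:R) <= d%:R * M ^+ 2 * p * (L + j%:R) by rewrite ler_wpM2r.
  have h2 : V * s <= d%:R * (d%:R * M ^+ 2 * p * (L + j%:R + 4)).
    have -> : V * s = d%:R * (V * (L + j%:R) + V * U) by rewrite sE; ring.
    by rewrite ler_wpM2l//; lra.
  have dM0 : 0 <= d%:R ^+ 2 * M ^+ 2 by rewrite mulr_ge0// sqr_ge0.
  have h3 : d%:R * (d%:R * M ^+ 2 * p * (L + j%:R + 4)) <=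
      d%:R ^+ 2 * M ^+ 2 * (r ^+ 2 * (L + j%:R + 4)).
    have -> : d%:R * (d%:R * M ^+ 2 * p * (L + j%:R + 4)) =
      d%:R ^+ 2 * M ^+ 2 * (p * (L + j%:R + 4)) by ring.
    by rewrite ler_wpM2l// ler_wpM2r//; lra.
  have -> : A ^+ 2 = d%:R ^+ 2 * M ^+ 2 * (r ^+ 2 * (2 * q + 5 + j%:R) ^+ 2).
    by rewrite /A; ring.
  have h4 : d%:R ^+ 2 * M ^+ 2 * (r ^+ 2 * (2 * (L + j%:R + 4))) <=
            d%:R ^+ 2 * M ^+ 2 * (r ^+ 2 * (2 * q + 5 + j%:R) ^+ 2).
    rewrite ler_wpM2l// ler_wpM2l ?sqr_ge0// -qE.
    have : 0 <= q * j%:R by rewrite mulr_ge0.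
    have : 0 <= q ^+ 2 by rewrite sqr_ge0.
    have : 0 <= j%:R ^+ 2 :> R by rewrite sqr_ge0.
    lra.
  lra.
have sT : s <= d%:R * (L + j%:R + d%:R).
  by rewrite sE -mulrDr ler_wpM2l//; lra.
have : Num.sqrt (s * (2 * V + s)) <= A + s.
  rewrite -[leRHS]ger0_norm ?addr_ge0// -sqrtr_sqr ler_sqrt ?sqr_ge0//.
  have : 0 <= A * s by rewrite mulr_ge0.
  have -> : s * (2 * V + s) = 2 * V * s + s ^+ 2 by ring.
  have -> : (A + s) ^+ 2 = A ^+ 2 + 2 * (A * s) + s ^+ 2 by ring.
  lra.
rewrite /A; lra.
Qed.

(** * One level of the chain *)

Definition grid_point (R : realType) (m d j : nat) (n : 'I_d -> nat) (i : 'I_d) :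
  R := (n i)%:R / (m * 2 ^ j)%:R.

Lemma grid_parent (R : realType) (m d j : nat) (n : 'I_d -> nat) (i : 'I_d) :
    (0 < m)%N -> (n i <= m * 2 ^ j.+1)%N ->
  let a := grid_point R m j.+1 n i in
  let b := grid_point R m j (uphalf \o n) i in
  [/\ 0 <= a, a <= b, b <= 1 & b - a <= (m * 2 ^ j.+1)%:R^-1].
Proof.
move=> m0 nm a b.
have H0 : 0 < (m * 2 ^ j.+1)%:R :> R by rewrite ltr0n muln_gt0 m0 expn_gt0.
have bE : b = (2 * uphalf (n i))%:R / (m * 2 ^ j.+1)%:R.
  rewrite /b /grid_point/= expnS mulnCA !natrM; field.
  by rewrite !pnatr_eq0 -!lt0n m0 expn_gt0.
have h1 : (n i <= 2 * uphalf (n i) <= (n i).+1)%N.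
  have := odd_double_half (n i); rewrite uphalf_half mul2n doubleD.
  by case: (odd _) => /= <-; lia.
have h2 : (2 * uphalf (n i) <= m * 2 ^ j.+1)%N.
  by rewrite expnS mulnCA leq_mul2l/=; move: nm; rewrite expnS mulnCA; lia.
have /andP[h3 h4] := h1.
split.
- by rewrite /a /grid_point divr_ge0// ltW.
- by rewrite bE /a /grid_point ler_pM2r ?invr_gt0// ler_nat.
- by rewrite bE ler_pdivrMr// mul1r ler_nat.
- rewrite bE /a /grid_point -mulrBl -[leRHS]mul1r ler_pM2r ?invr_gt0//.
  by rewrite lerBlDl natr1 ler_nat.
Qed.

(** The sum factors over the coordinates into d equal geometric sums, each at
    most 2 m 2^j / d; the factor expR (- (L + j)) absorbs this bound. *)
Lemma sum_weights_le1 (R : realType) (m d j : nat) (L : R) : (0 < d <= m)%N ->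
    expR (- L) <= d%:R / (4 * expR 1 * m%:R) ->
  \sum_(f : {ffun 'I_d -> 'I_(m * 2 ^ j).+1})
     expR (- (d%:R * (L + j%:R) +
        d%:R * \sum_(i < d) (1 - grid_point R m j (fun k => f k : nat) i))) <= 1.
Proof.
move=> /andP[d0 dm] hL; have d0' : 0 < d%:R :> R by rewrite ltr0n.
have m0' : 0 < m%:R :> R by rewrite ltr0n (leq_trans d0).
have p0 : 0 < 2 ^+ j :> R by rewrite exprn_gt0.
pose F (k : nat) : R := expR (- (L + j%:R)) *
  expR (- (d%:R * (1 - k%:R / (m * 2 ^ j)%:R))).
rewrite (eq_bigr (fun f : {ffun 'I_d -> 'I_(m * 2 ^ j).+1} =>
  \prod_(i < d) F (f i))); last first.
  move=> f _; rewrite /F [RHS]big_split/= prodr_const card_ord -expRM_natl -expR_sum.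
  by rewrite -expRD sumrN -mulr_sumr opprD mulrN.
rewrite -(bigA_distr_bigA (fun _ (k : 'I_(m * 2 ^ j).+1) => F k)) /=.
rewrite prodr_const card_ord; apply: exprn_ile1.
  by apply: sumr_ge0 => k _; rewrite mulr_ge0// expR_ge0.
rewrite /F -mulr_sumr.
apply: (@le_trans _ _ (d%:R / (4 * expR 1 * m%:R) * (2 ^+ j)^-1 *
    (2 * (m * 2 ^ j)%:R / d%:R))).
  apply: ler_pM => //.
  - by apply: sumr_ge0 => k _; exact: expR_ge0.
  - rewrite opprD expRD; apply: ler_pM; rewrite ?expR_ge0//.
    rewrite expRN lef_pV2 ?posrE ?expR_gt0// -[j%:R]mul1r expRM_natr.
    rewrite lerXn2r ?nnegrE ?expR_ge0//; have := expR_ge1Dx (1 : R); lra.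
  - apply: geo_sum_le => //; rewrite ler_nat (leq_trans dm)// leq_pmulr//.
    by rewrite expn_gt0.
have e0 : 2 <= expR 1 :> R by have := expR_ge1Dx (1 : R); lra.
have -> : d%:R / (4 * expR 1 * m%:R) * (2 ^+ j)^-1 * (2 * (m * 2 ^ j)%:R / d%:R) =
    (2 * expR 1)^-1 :> R.
  rewrite natrM natrX; field; rewrite !gt_eqF//; lra.
by rewrite invf_le1; lra.
Qed.

(** The random variable E gathers the excesses of all the increments of the
    level, so it serves every grid point simultaneously. *)
Lemma level_excess (R : realType) (m d : nat) (dO : measure_display)
    (Omega : measurableType dO) (Pr : probability Omega R)
    (X : d.-tuple 'I_m -> {RV Pr >-> d.-tuple R}) (hX : jittered_sampling X)
    (L : R) (j : nat) :
    (2 <= d <= m)%N -> 1 <= L -> expR (- L) <= d%:R / (4 * expR 1 * m%:R) ->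
  let M := Num.sqrt (m%:R ^+ d.-1) : R in
  exists E : Omega -> R, [/\ measurable_fun setT E, forall w, 0 <= E w,
    forall n : 'I_d -> nat, (forall i, (n i <= m * 2 ^ j.+1)%N) -> forall w,
      `|box_disc X (grid_point R m j (uphalf \o n)) w -
        box_disc X (grid_point R m j.+1 n) w| <=
      2 * d%:R * M * (3 / 4) ^+ j.+1 * (2 * Num.sqrt L + 5 + j.+1%:R) +
      2 * d%:R * (L + j.+1%:R + d%:R) + E w &
    (\int[Pr]_w (E w)%:E <= (2 + 2 * d%:R * M * (3 / 4) ^+ j.+1)%:E)%E].
Proof.
move=> /andP[d2 dm] L1 hL M.
have d0 : (0 < d)%N by exact: leq_trans d2.
have m0 : (0 < m)%N by exact: leq_trans dm.
have d0' : 0 < d%:R :> R by rewrite ltr0n.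
have m0' : 0 < m%:R :> R by rewrite ltr0n.
have M0 : 0 <= M by exact: sqrtr_ge0.
have ME : M ^+ 2 = m%:R ^+ d.-1 by rewrite sqr_sqrtr// exprn_ge0.
set r : R := (3 / 4) ^+ j.+1; set p : R := 2^-1 ^+ j.+1.
have r0 : 0 <= r by rewrite /r exprn_ge0//; lra.
have pr : p <= r ^+ 2.
  rewrite /p /r -exprM mulnC exprM lerXn2r ?nnegrE//; lra.
pose a n := grid_point R m j.+1 (n : 'I_d -> nat).
pose b n := grid_point R m j (uphalf \o (n : 'I_d -> nat)).
pose V n := m%:R ^+ d * (\prod_(i < d) b n i - \prod_(i < d) a n i).
pose U n := \sum_(i < d) (1 - a n i).
pose s n := d%:R * (L + j.+1%:R) + d%:R * U n.
pose good (n : 'I_d -> nat) := forall i, (n i <= m * 2 ^ j.+1)%N.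
have ab n : good n -> forall i, [/\ 0 <= a n i, a n i <= b n i, b n i <= 1 &
    b n i - a n i <= (m * 2 ^ j.+1)%:R^-1].
  by move=> gn i; apply: grid_parent.
have ab3 n : good n -> forall i, [/\ 0 <= a n i, a n i <= b n i & b n i <= 1].
  by move=> gn i; case: (ab _ gn i).
have U01 n : good n -> 0 <= U n <= d%:R.
  move=> gn; apply/andP; split.
    by apply: sumr_ge0 => i _; case: (ab _ gn i) => *; lra.
  rewrite -[X in _ <= X%:R](card_ord d) -sum1_card natr_sum.
  by apply: ler_sum => i _; case: (ab _ gn i) => *; lra.
(* This is where L >= 1 keeps the weights away from 0. *)
have s1 n : good n -> 1 <= s n.
  move=> /U01 /andP[U0 _]; rewrite /s -mulrDr.
  have : 1 <= d%:R :> R by rewrite ler1n.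
  have : 0 <= j.+1%:R :> R by [].
  nra.
have Vb n : good n -> [/\ 0 <= V n, V n <= d%:R * M ^+ 2 * p &
    V n * U n <= 4 * (d%:R * M ^+ 2 * p)].
  move=> gn.
  have hE : m%:R ^+ d * (d%:R * (m * 2 ^ j.+1)%:R^-1) = d%:R * M ^+ 2 * p :> R.
    have -> : m%:R ^+ d = m%:R * m%:R ^+ d.-1 :> R by rewrite -exprS prednK.
    have T0 : 2 ^+ j.+1 != 0 :> R by rewrite expf_neq0.
    rewrite ME /p natrM natrX exprVn; move: (2 ^+ j.+1) T0 => T T0.
    by field; rewrite T0 gt_eqF.
  have h0 : 0 <= (m * 2 ^ j.+1)%:R^-1 :> R by rewrite invr_ge0.
  have dh : d%:R * (m * 2 ^ j.+1)%:R^-1 <= 1 :> R.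
    rewrite ler_pdivrMr ?mul1r ?ltr0n ?muln_gt0 ?m0 ?expn_gt0//.
    by rewrite ler_nat (leq_trans dm)// leq_pmulr// expn_gt0.
  have [h1 h2] := prodB_unit_le d0 h0 dh (ab _ gn).
  have md0 : 0 <= m%:R ^+ d :> R by rewrite exprn_ge0.
  split.
  - rewrite /V mulr_ge0// subr_ge0; apply: ler_prod => i _.
    by case: (ab3 _ gn i) => -> ->.
  - by rewrite -hE ler_wpM2l.
  - by rewrite -hE /V -mulrA [leRHS]mulrCA ler_wpM2l.
pose g (f : {ffun 'I_d -> 'I_(m * 2 ^ j.+1).+1}) (i : 'I_d) : nat := f i.
have gg f : good (g f) by move=> i; rewrite -ltnS /g.
have /choice[Z hZ] f := increment_excess hX m0 (s1 _ (gg f)) (ab3 _ (gg f)).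
exists (fun w => \sum_f Z f w); split.
- by apply: measurable_sum => f; case: (hZ f).
- by move=> w; apply: sumr_ge0 => f _; case: (hZ f).
- move=> n gn w; pose f : {ffun 'I_d -> 'I_(m * 2 ^ j.+1).+1} :=
    [ffun i => inord (n i)].
  have fn : g f = n by apply/funext => i; rewrite /g /f ffunE inordK// ltnS.
  have [_ Z0 /(_ w) hw _] := hZ f.
  rewrite fn -/(V n) -/(a n) -/(b n) in hw.
  apply: le_trans hw _; apply: lerD; last first.
    rewrite (bigD1 f)//= lerDl; apply: sumr_ge0 => f' _.
    by case: (hZ f').
  have /andP[U0 Ud] := U01 _ gn; have [V0 V1 V2] := Vb _ gn.
  exact: threshold_le d0 M0 V0 U0 Ud L1 r0 pr V1 V2 erefl.
under eq_integral do rewrite -sumEFin.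
rewrite ge0_integral_sum//; last 2 first.
- by move=> f; apply/measurable_EFinP; case: (hZ f).
- by move=> f w _; rewrite lee_fin; case: (hZ f).
set C := 2 + _.
have C0 : 0 <= C by rewrite /C addr_ge0// !mulr_ge0// ltW.
apply: (@le_trans _ _ (\sum_f (C * expR (- s (g f)))%:E)%E).
  apply: lee_sum => f _; have [_ _ _ h] := hZ f; apply: le_trans h _.
  rewrite lee_fin ler_wpM2r ?expR_ge0// /C mulrDr mulr1 lerD2l.
  have [V0 V1 _] := Vb _ (gg f); rewrite -/(a _) -/(b _) -/(V _).
  rewrite -!mulrA ler_wpM2l// mulrA.
  have dMr : 0 <= d%:R * M * r by rewrite !mulr_ge0// ltW.
  rewrite -[leRHS](ger0_norm dMr) -sqrtr_sqr ler_sqrt ?sqr_ge0//.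
  have h1 : d%:R * M ^+ 2 * p <= d%:R * M ^+ 2 * r ^+ 2.
    by rewrite ler_wpM2l// mulr_ge0 ?sqr_ge0// ltW.
  have h2 : 2 * (d%:R * M ^+ 2 * r ^+ 2) <= d%:R * (d%:R * M ^+ 2 * r ^+ 2).
    by rewrite ler_wpM2r ?ler_nat// !mulr_ge0 ?sqr_ge0// ltW.
  have -> : (d%:R * M * r) ^+ 2 = d%:R * (d%:R * M ^+ 2 * r ^+ 2) by ring.
  lra.
rewrite sumEFin lee_fin -mulr_sumr -[leRHS]mulr1 ler_wpM2l//.
by apply: sum_weights_le1 => //; rewrite d0.
Qed.

(** * Chaining all levels *)

(** The chain ends at the m-grid, where the discrepancy vanishes. *)
Lemma chain_le (R : realType) (m d : nat) (dO : measure_display)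
    (Omega : measurableType dO) (Pr : probability Omega R)
    (X : d.-tuple 'I_m -> {RV Pr >-> d.-tuple R}) (hX : jittered_sampling X)
    (t : nat -> R) (w : Omega) : (0 < m)%N ->
    (forall j (n : 'I_d -> nat), (forall i, (n i <= m * 2 ^ j.+1)%N) ->
      `|box_disc X (grid_point R m j (uphalf \o n)) w -
        box_disc X (grid_point R m j.+1 n) w| <= t j) ->
  forall K (n : 'I_d -> nat), (forall i, (n i <= m * 2 ^ K)%N) ->
  `|box_disc X (grid_point R m K n) w| <= \sum_(j < K) t j.
Proof.
case: hX => inC unif _ m0 ht; elim=> [|K IH] n nm.
  rewrite big_ord0.
  have -> : grid_point R m 0 n = fun i => (n i)%:R / m%:R.
    by apply/funext => i; rewrite /grid_point expn0 muln1.
  by rewrite box_disc_grid ?normr0// => i; rewrite -[m]muln1.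
rewrite big_ord_recr/=.
have -> : box_disc X (grid_point R m K.+1 n) w =
  box_disc X (grid_point R m K (uphalf \o n)) w -
  (box_disc X (grid_point R m K (uphalf \o n)) w -
   box_disc X (grid_point R m K.+1 n) w) by ring.
apply: le_trans (ler_normB _ _) _; apply: lerD; last exact: ht.
apply: IH => i /=; rewrite leq_uphalf_double -mul2n mulnCA -expnS; exact: nm.
Qed.

(** Round the corner down and up to the grid of level K. *)
Lemma star_discrepancy_le (R : realType) (m d : nat) (dO : measure_display)
    (Omega : measurableType dO) (Pr : probability Omega R)
    (X : d.-tuple 'I_m -> {RV Pr >-> d.-tuple R}) (hX : jittered_sampling X)
    (w : Omega) (K : nat) (T : R) : (0 < d <= m)%N ->
    (forall n : 'I_d -> nat, (forall i, (n i <= m * 2 ^ K)%N) ->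
      `|box_disc X (grid_point R m K n) w| <= T) ->
  0 <= star_discrepancy (jittered_point_set X w) <=
  T + m%:R ^+ d * (d%:R / (m * 2 ^ K)%:R).
Proof.
case: hX => inC unif _ /andP[d0 dm] hT; have m0 : (0 < m)%N by exact: leq_trans dm.
rewrite /star_discrepancy; set e := _ * _; set D := [set _ | _ in _].
have H0 : (0 < m * 2 ^ K)%N by rewrite muln_gt0 m0 expn_gt0.
have H0' : 0 < (m * 2 ^ K)%:R :> R by rewrite ltr0n.
have D_ub : ubound D (T + e).
  move=> _ [x x01 <-].
  have {}x01 i : 0 <= tnth x i < 1 by exact: x01.
  rewrite disc_anchored_box//; last by move=> i; case/andP: (x01 i).
  pose n i := Num.truncn (tnth x i * (m * 2 ^ K)%:R).
  have n_itv i : (n i)%:R <= tnth x i * (m * 2 ^ K)%:R < (n i).+1%:R.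
    by apply: truncn_itv; rewrite mulr_ge0//; case/andP: (x01 i).
  have n_lt i : (n i < m * 2 ^ K)%N.
    have /andP[h _] := n_itv i; rewrite -(ltr_nat R); apply: le_lt_trans h _.
    by rewrite -[ltRHS]mul1r ltr_pM2r//; case/andP: (x01 i).
  pose a := grid_point R m K n; pose b := grid_point R m K (succn \o n).
  have ax i : a i <= tnth x i.
    by rewrite /a /grid_point ler_pdivrMr//; case/andP: (n_itv i).
  have xb i : tnth x i <= b i.
    by rewrite /b /grid_point ler_pdivlMr//; case/andP: (n_itv i) => _ /ltW.
  have a0 i : 0 <= a i by rewrite /a /grid_point divr_ge0.
  (* The bracketing corners differ by one step of the grid in each coordinate. *)
  apply: (@box_disc_bracket _ _ _ _ _ _ _ a _ b) => //.
  - by apply: hT => i; exact: ltnW.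
  - by apply: hT => i; exact: n_lt.
  rewrite /e ler_wpM2l ?exprn_ge0//.
  apply: (prodB_unit_le d0 _ _ _).1.
  - by rewrite invr_ge0 ltW.
  - by rewrite ler_pdivrMr// mul1r ler_nat (leq_trans dm)// leq_pmulr// expn_gt0.
  - move=> i; split=> //.
    + exact: le_trans (ax i) (xb i).
    + by rewrite /b /grid_point ler_pdivrMr// mul1r ler_nat; exact: n_lt.
    + by rewrite /b /a /grid_point/= -mulrBl -natr1 addrAC subrr add0r mul1r.
have D0 : exists2 y, D y & 0 <= y.
  exists `|disc (jittered_point_set X w) (anchored_box [tuple 0 | i < d])| => //.
  exists [tuple 0 | i < d] => //.
  by move=> i; rewrite tnth_mktuple lexx ltr01.
case: D0 => y Dy y0; apply/andP; split.
  by apply: le_trans y0 _; apply: ub_le_sup => //; exists (T + e).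
by apply: ge_sup => //; exists y.
Qed.

(** K levels are used: 2 ^ K is at least sqrt (m ^ (d - 1)), and less than
    twice as large, while ln m and d are both O(K). *)
Lemma up_log4_bounds (m d : nat) : (2 <= d <= m)%N ->
  let K := up_log 4 (m ^ d.-1) in
  [/\ (0 < K)%N, (4 ^ K.-1 < m ^ d.-1)%N, (m ^ d.-1 <= 4 ^ K)%N,
      (m <= 4 ^ K)%N & (d <= (2 * K).+1)%N].
Proof.
move=> /andP[d2 dm] K; have m2 : (2 <= m)%N by exact: leq_trans dm.
have md : (1 < m ^ d.-1)%N by rewrite -[1%N](exp1n d.-1) ltn_exp2r//; lia.
have /andP[h1 h2] := up_log_bounds (isT : (1 < 4)%N) md.
split => //; first by rewrite up_log_gt0.
  by apply: leq_trans h2; rewrite -[X in (X <= _)%N]expn1 leq_pexp2l//; lia.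
have : (2 ^ d.-1 <= 2 ^ (2 * K))%N.
  by rewrite expnM; apply: leq_trans h2; rewrite leq_exp2r; lia.
by rewrite leq_exp2l//; lia.
Qed.

Lemma sqr_le_exp2 (K : nat) : (K ^ 2 <= 2 ^ K.+1)%N.
Proof.
have [|K3] := ltnP K 3; first by case: K => [|[|[|]]].
elim: K K3 => // K IH; rewrite ltnS leq_eqVlt => /predU1P[<-//|K3].
by rewrite expnS; apply: leq_trans (leq_mul (leqnn 2) (IH K3)); nia.
Qed.

Lemma log_bounds (R : realType) (m d K : nat) : (2 <= d <= m)%N ->
    (m <= 4 ^ K)%N ->
  let L := ln (4 * expR 1 * m%:R / d%:R) : R in
  [/\ 1 <= L, expR (- L) = d%:R / (4 * expR 1 * m%:R) & L <= 2 + 2 * K%:R].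
Proof.
move=> /andP[d2 dm] mK L.
have d2' : 2 <= d%:R :> R by rewrite ler_nat.
have dm' : d%:R <= m%:R :> R by rewrite ler_nat.
have e2 : 2 <= expR 1 :> R by have := expR_ge1Dx (1 : R); lra.
have y0 : 0 < 4 * expR 1 * m%:R / d%:R :> R.
  by rewrite divr_gt0 ?mulr_gt0//; lra.
have eL : expR L = 4 * expR 1 * m%:R / d%:R by rewrite lnK.
split; first 1 last.
- by rewrite expRN eL invf_div.
- rewrite -ler_expR eL expRD.
  have -> : expR (2 * K%:R) = (expR 1 ^+ 2) ^+ K :> R.
    by rewrite -expRM_natr -expRM_natr mul1r.
  have -> : expR 2 = expR 1 ^+ 2 :> R by rewrite -expRM_natr mul1r.
  have h4 : m%:R <= (expR 1 ^+ 2) ^+ K :> R.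
    apply: (@le_trans _ _ (4 ^+ K)); first by rewrite -natrX ler_nat.
    rewrite lerXn2r ?nnegrE ?sqr_ge0//; nra.
  rewrite ler_pdivrMr; last by lra.
  have -> : expR 1 ^+ 2 * (expR 1 ^+ 2) ^+ K * d%:R =
    expR 1 * (expR 1 * d%:R) * (expR 1 ^+ 2) ^+ K :> R by ring.
  apply: ler_pM => //; rewrite ?mulr_ge0//; try lra.
  by rewrite mulrC ler_wpM2l//; nra.
- rewrite -ler_expR eL ler_pdivlMr; last by lra.
  have : expR 1 * d%:R <= expR 1 * m%:R :> R by rewrite ler_wpM2l//; lra.
  have : 0 <= expR 1 * m%:R :> R by rewrite mulr_ge0//; lra.
  lra.
Qed.

(** The Gaussian terms and the excesses sum to
    d M (12 sqrt L + 60), the Bernstein corrections, with the constant 2 of each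
    level, to at most 17 d K ^+ 2 <= 68 d M. *)
Lemma chaining_total_le (R : realType) (d K : nat) (M L : R) :
    (2 <= d)%N -> (0 < K)%N -> (d <= (2 * K).+1)%N -> 0 <= M ->
    K%:R ^+ 2 <= 4 * M -> 0 <= L -> L <= 2 + 2 * K%:R ->
  \sum_(j < K) (2 * d%:R * M * (3 / 4) ^+ j.+1 * (2 * Num.sqrt L + 5 + j.+1%:R) +
     2 * d%:R * (L + j.+1%:R + d%:R) + (2 + 2 * d%:R * M * (3 / 4) ^+ j.+1)) <=
  d%:R * M * (12 * Num.sqrt L + 128).
Proof.
move=> d2 K0 dK M0 KM L0 LK.
have d2' : 2 <= d%:R :> R by rewrite ler_nat.
have K1 : 1 <= K%:R :> R by rewrite ler1n.
have dK' : d%:R <= 2 * K%:R + 1 :> R by rewrite -natrM natr1 ler_nat.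
have q0 : 0 <= Num.sqrt L by [].
have dM0 : 0 <= d%:R * M by rewrite mulr_ge0.
set q := Num.sqrt L in q0 *.
pose B := 2 * d%:R * (L + K%:R + d%:R) + 2.
apply: (@le_trans _ _ (\sum_(j < K)
    (2 * (d%:R * M) * ((2 * q + 6 + j.+1%:R) * (3 / 4) ^+ j.+1) + B))).
  apply: ler_sum => j _; have jK : j.+1%:R <= K%:R :> R by rewrite ler_nat.
  have : d%:R * j.+1%:R <= d%:R * K%:R :> R by rewrite ler_wpM2l//; lra.
  rewrite /B; lra.
rewrite big_split/= -mulr_sumr sumr_const card_ord -[B *+ K]mulr_natl.
have c0 : 0 <= 2 * q + 6 by lra.
have h1 := ler_wpM2l dM0 (sum_geo34 K c0).
have hB : B <= d%:R * (2 * (5 * K%:R + 3) + 1).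
  have : d%:R * (L + K%:R + d%:R) <= d%:R * (5 * K%:R + 3) by rewrite ler_wpM2l//; lra.
  rewrite /B; lra.
have hB' : B <= 17 * d%:R * K%:R.
  have : d%:R * 1 <= d%:R * K%:R :> R by rewrite ler_wpM2l//; lra.
  lra.
have hKB : K%:R * B <= 17 * d%:R * K%:R ^+ 2.
  have -> : 17 * d%:R * K%:R ^+ 2 = K%:R * (17 * d%:R * K%:R) :> R by ring.
  by rewrite ler_wpM2l//; lra.
have hKM : d%:R * K%:R ^+ 2 <= d%:R * (4 * M) by rewrite ler_wpM2l//; lra.
lra.
Qed.

(** The remaining d M is the cost of rounding a corner to the grid of
    level K. *)
Lemma expectation_star_discrepancy_le (R : realType) (m d : nat)
    (dO : measure_display) (Omega : measurableType dO)
    (Pr : probability Omega R)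
    (X : d.-tuple 'I_m -> {RV Pr >-> d.-tuple R})
    (hX : jittered_sampling X) : (2 <= d <= m)%N ->
  ('E_Pr[fun w => star_discrepancy (jittered_point_set X w)] <=
   (d%:R * Num.sqrt (m%:R ^+ d.-1) *
    (12 * Num.sqrt (ln (4 * expR 1 * m%:R / d%:R)) + 129))%:E)%E.
Proof.
move=> dm; have /andP[hd hm] := dm.
have d0 : (0 < d)%N by exact: leq_trans hd.
have dm0 : (0 < d <= m)%N by rewrite d0.
have m0 : (0 < m)%N by exact: leq_trans hm.
have d0' : 0 < d%:R :> R by rewrite ltr0n.
have m0' : 0 < m%:R :> R by rewrite ltr0n.
have [K0 K1 K2 mK dK] := up_log4_bounds dm.
set K := up_log _ _ in K0 K1 K2 mK dK.
have [L1 hL LK] := log_bounds R dm mK.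
set L := ln _ in L1 hL LK *.
set M := Num.sqrt (m%:R ^+ d.-1).
have M0 : 0 <= M by exact: sqrtr_ge0.
have ME : M ^+ 2 = m%:R ^+ d.-1 by rewrite sqr_sqrtr// exprn_ge0.
have mdE : m%:R ^+ d = m%:R * M ^+ 2 :> R by rewrite ME -exprS prednK.
have sqrt4 k : Num.sqrt ((4 ^ k)%:R : R) = 2 ^+ k.
  have -> : (4 ^ k)%:R = (2 ^+ k) ^+ 2 :> R by rewrite -exprM mulnC -natrX expnM.
  by rewrite sqrtr_sqr ger0_norm// exprn_ge0.
have MK : M <= 2 ^+ K by rewrite -sqrt4 ler_sqrt// -natrX ler_nat.
have KM : K%:R ^+ 2 <= 4 * M.
  have h1 : 2 ^+ K.-1 <= M by rewrite -sqrt4 ler_sqrt ?exprn_ge0// -natrX ler_nat ltnW.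
  apply: (@le_trans _ _ (4 * 2 ^+ K.-1)); last by lra.
  have := sqr_le_exp2 K; rewrite -{2}(prednK K0) -(ler_nat R) !natrX !exprS.
  lra.
pose T j : R := 2 * d%:R * M * (3 / 4) ^+ j.+1 * (2 * Num.sqrt L + 5 + j.+1%:R) +
      2 * d%:R * (L + j.+1%:R + d%:R).
have hL' : expR (- L) <= d%:R / (4 * expR 1 * m%:R) by rewrite hL.
have /choice[E hE] j := level_excess hX j dm L1 hL'.
have eE : m%:R ^+ d * (d%:R / (m * 2 ^ K)%:R) <= d%:R * M.
  rewrite mdE.
  have P0 : 0 < 2 ^+ K :> R by rewrite exprn_gt0.
  rewrite natrM natrX.
  have -> : m%:R * M ^+ 2 * (d%:R / (m%:R * 2 ^+ K)) = d%:R * M * (M / 2 ^+ K).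
    by field; rewrite !gt_eqF.
  rewrite ler_piMr ?mulr_ge0 ?(ltW d0')//.
  by rewrite ler_pdivrMr// mul1r.
pose C := \sum_(j < K) T j + d%:R * M.
have T0 j : 0 <= T j.
  have r0 : 0 <= (3 / 4) ^+ j.+1 :> R by apply: exprn_ge0; lra.
  have d0w := ltW d0'; have q0 : 0 <= Num.sqrt L by exact: sqrtr_ge0.
  have j0 : 0 <= j.+1%:R :> R by exact: ler0n.
  apply: addr_ge0; apply: mulr_ge0; rewrite ?mulr_ge0//; lra.
have C0 : 0 <= C.
  apply: addr_ge0; last by apply: mulr_ge0 => //; exact: ltW.
  by apply: sumr_ge0 => j _; exact: T0.
have pointwise w : 0 <= star_discrepancy (jittered_point_set X w) <=
    C + \sum_(j < K) E j w.
  have level j n : (forall i, (n i <= m * 2 ^ j.+1)%N) ->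
      `|box_disc X (grid_point R m j (uphalf \o n)) w -
        box_disc X (grid_point R m j.+1 n) w| <= T j + E j w.
    by move=> nm; have [_ _ h _] := hE j; exact: h.
  have /andP[-> h] := star_discrepancy_le hX dm0 (chain_le hX m0 level (K := K)).
  apply: le_trans h _; rewrite big_split/= /C; lra.
rewrite unlock; apply: (@le_trans _ _ (\int[Pr]_w (C + \sum_(j < K) E j w)%:E)%E).
  by apply: le_integral_ge0 => w; rewrite lee_fin; case/andP: (pointwise w).
have mE j : measurable_fun setT (E j) by case: (hE j).
have E0 j w : 0 <= E j w by case: (hE j).
under eq_integral do rewrite EFinD.
rewrite ge0_integralD//; last 2 first.
- by move=> w _; rewrite lee_fin sumr_ge0.
- by apply/measurable_EFinP; exact: measurable_sum.
rewrite integral_cst// [X in (C%:E * X)%E](_ : _ = 1%E); last exact: probability_setT.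
rewrite mule1.
under eq_integral do rewrite -sumEFin.
rewrite ge0_integral_sum//; last 2 first.
- by move=> j; apply/measurable_EFinP.
- by move=> j w _; rewrite lee_fin.
apply: (@le_trans _ _ (C%:E + \sum_(j < K) (2 + 2 * d%:R * M * (3 / 4) ^+ j.+1)%:E)%E).
  by rewrite leeD2l//; apply: lee_sum => j _; case: (hE j).
rewrite sumEFin -EFinD lee_fin /C addrAC -big_split/=.
have := chaining_total_le hd K0 dK M0 KM (_ : 0 <= L) LK.
move=> /(_ (le_trans ler01 L1)) h.
apply: le_trans (lerD h (lexx _)) _; lra.
Qed.

Theorem theorem7 (R : realType) (m d : nat) (hd : (2 <= d)%N) (hm : (d <= m)%N)
    (dO : measure_display) (Omega : measurableType dO)
    (Pr : probability Omega R)
    (X : d.-tuple 'I_m -> {RV Pr >-> d.-tuple R})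
    (hX : jittered_sampling X) :
  ('E_Pr[fun w => star_discrepancy (jittered_point_set X w)] <=
   ((60 + 99 / 10 ^+ 2 + 84 / 10 ^+ 4) * Num.sqrt (d%:R * m%:R ^+ d) *
    ((Num.sqrt (ln (4 * expR 1 * m%:R / d%:R)) +
      (2 + 95 / 10 ^+ 2 + 99 / 10 ^+ 4)) /
     Num.sqrt (m%:R / d%:R)))%:E)%E.
Proof.
have dm : (2 <= d <= m)%N by rewrite hd.
have d0 : (0 < d)%N by exact: leq_trans hd.
have d0' : 0 < d%:R :> R by rewrite ltr0n.
have m0' : 0 < m%:R :> R by rewrite ltr0n (leq_trans d0).
apply: le_trans (expectation_star_discrepancy_le hX dm) _; rewrite lee_fin.
pose M : R := Num.sqrt (m%:R ^+ d.-1); rewrite -/M.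
have dM0 : 0 <= d%:R * M by rewrite mulr_ge0// ?sqrtr_ge0// ltW.
have -> : Num.sqrt (d%:R * m%:R ^+ d) = d%:R * M * Num.sqrt (m%:R / d%:R).
  have -> : d%:R * m%:R ^+ d = (d%:R * M) ^+ 2 * (m%:R / d%:R) :> R.
    rewrite exprMn sqr_sqrtr ?exprn_ge0//.
    have -> : m%:R ^+ d = m%:R * m%:R ^+ d.-1 :> R by rewrite -exprS prednK.
    by field; rewrite gt_eqF.
  by rewrite sqrtrM ?sqr_ge0// sqrtr_sqr ger0_norm.
set A := Num.sqrt (m%:R / d%:R); set q := Num.sqrt (ln _).
have A0 : 0 < A by rewrite sqrtr_gt0 divr_gt0.
have q0 : 0 <= q by exact: sqrtr_ge0.
rewrite [leRHS](_ : _ = d%:R * M * ((60 + 99 / 10 ^+ 2 + 84 / 10 ^+ 4) *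
  (q + (2 + 95 / 10 ^+ 2 + 99 / 10 ^+ 4)))); last by field; rewrite gt_eqF.
by rewrite ler_wpM2l//; lra.
Qed.
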